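(* Let $\sigma>0$. The characteristic curvature of the centered normal distribution $N(0,\sigma^2)$, whose characteristic function is $\varphi_X(u)=e^{-\frac12\sigma^2u^2}$, equals its standard deviation: $$\Phi=\sigma .$$
   Context: The characteristic curvature of a probability distribution symmetric around zero with characteristic function $\varphi_X(u)=\mathbb{E}(e^{iuX})$ is $$\Phi=\frac{2}{\sqrt{2\pi}}\int_{0}^{\infty}\Big(-\frac{\partial^2\ln\varphi_X(u)}{\partial u^2}\Big)\varphi_X(u)\,du,$$ where $\varphi_X$ is considered on $u\ge 0$. *)

(* Defs.v *)
From HB Require Import structures.
From mathcomp Require Import all_boot all_order all_algebra.
From mathcomp Require Import all_classical all_reals all_analysis.
From mathcomp Require Import complex.

Set Implicit Arguments.
Unset Strict Implicit.
Unset Printing Implicit Defensive.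

Import Order.TTheory GRing.Theory Num.Theory.
Import numFieldNormedType.Exports.

Local Open Scope classical_set_scope.
Local Open Scope ring_scope.
Local Open Scope complex_scope.

Definition symmetric_prob (R : realType) (P : probability (measurableTypeR R) R)
    : Prop :=
  forall A : set R, measurable A -> P [set - x | x in A] = P A.

(* e^(it) *)
Definition expi (R : realType) (t : R) : R[i] := cos t +i* sin t.

(* Taken componentwise; [fine] loses nothing when f is bounded and measurable,
   as in [charfun]. *)
Definition cexpectation (R : realType) (P : probability (measurableTypeR R) R)
    (f : R -> R[i]) : R[i] :=
  fine 'E_P[fun x => complex.Re (f x)] +i* fine 'E_P[fun x => complex.Im (f x)].

Definition charfun (R : realType) (P : probability (measurableTypeR R) R)
    (u : R) : R[i] :=
  cexpectation P (fun x => expi (u * x)).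

(* Meant for P symmetric around zero: the characteristic function is then
   real-valued and coincides with its real part. The derivatives are two-sided;
   on [0, +oo[ this differs from the derivatives of the restriction to u >= 0
   at most at the endpoint 0, which is negligible for the integral. The value
   is an extended real, so that an equation with a real number includes the
   convergence of the integral. *)
Definition characteristic_curvature (R : realType)
    (P : probability (measurableTypeR R) R) : \bar R :=
  let phi := fun u : R => complex.Re (charfun P u) in
  ((2 / Num.sqrt (2 * pi))%:E *
   \int[lebesgue_measure]_(u in `[0%R, +oo[)
     (- derive1n 2 (fun v => ln (phi v)) u * phi u)%:E)%E.

(* Main.v *)
Require Import Defs.
From mathcomp Require Import all_boot all_order all_algebra.
From mathcomp Require Import all_classical all_reals all_analysis.
From mathcomp Require Import measurable_realfun.
From mathcomp Require Import complex.
From mathcomp Require Import ring lra.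

Import Order.TTheory GRing.Theory Num.Theory.
Import numFieldNormedType.Exports.

Local Open Scope classical_set_scope.
Local Open Scope ring_scope.
Local Open Scope complex_scope.

(** The characteristic function of N(0, s^2) is found by the classical
differential equation. Write p for the density and
G(u) = int cos(u x) p(x) dx. Differentiating under the integral sign gives
G'(u) = - int x sin(u x) p(x) dx, and since x p(x) = - s^2 p'(x), an
integration by parts turns this into G'(u) = - s^2 u G(u). As G(0) = 1, it
follows that G(u) exp(s^2 u^2 / 2) is constantly 1
([is_derive_normal_cos_transform], [normal_cos_transformE]). The imaginary part
of the characteristic function is the expectation of an odd function, hence
zero by the symmetry of the distribution ([symmetric_normal_prob],
[expectation_odd]).

The logarithm of the characteristic function is therefore the parabola
- s^2 u^2 / 2, with second derivative - s^2, and the integrand of the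
characteristic curvature is s^2 exp(- s^2 u^2 / 2). This is s^2 times the
unnormalized Gaussian with standard deviation 1 / s, whose integral over
[0, +oo[ is sqrt(2 pi) / (2 s) ([integral0y_normal_fun]); the factor
2 / sqrt(2 pi) then leaves s. *)

(** * Symmetry of the centered normal distribution *)

Lemma image_opprE (R : realType) (A : set R) :
  [set - x | x in A] = -%R @^-1` A.
Proof.
apply/seteqP; split=> [_ [x Ax <-]|x Ax] /=; first by rewrite opprK.
by exists (- x) => //; rewrite opprK.
Qed.

Lemma normal_pdf0N (R : realType) (s x : R) : s != 0 ->
  normal_pdf 0 s (- x) = normal_pdf 0 s x.
Proof. by move=> s0; rewrite normal_pdfE// /normal_fun !subr0 sqrrN. Qed.

(** The density is even, and Lebesgue measure is invariant under x |-> - x. *)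
Lemma symmetric_normal_prob (R : realType) (s : R) : s != 0 ->
  symmetric_prob (normal_prob 0 s).
Proof.
move=> s0 A mA.
have mp : measurable_fun A (EFin \o normal_pdf 0 s).
  by apply/measurable_EFinP/measurable_funTS; exact: measurable_normal_pdf.
rewrite image_opprE /normal_prob /=; apply/esym.
transitivity (\int[pushforward lebesgue_measure
    (-%R : measurableTypeR R -> measurableTypeR R)]_(x in A)
    (normal_pdf 0 s x)%:E)%E.
  by apply: eq_measure_integral => B mB _; exact/esym/lebesgue_measureN.
rewrite ge0_integral_pushforward//; last first.
  by move=> x _; rewrite lee_fin normal_pdf_ge0.
by apply: eq_integral => x _ /=; rewrite normal_pdf0N.
Qed.

(** Pushing P forward along x |-> - x shows that the expectation equals its own
opposite; integrability excludes infinite values. *)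
Lemma expectation_odd (R : realType) (P : probability (measurableTypeR R) R)
    (f : R -> R) :
  symmetric_prob P -> P.-integrable setT (EFin \o f) ->
  (forall x, f (- x) = - f x) -> ('E_P[f] = 0)%E.
Proof.
move=> symP intf fN.
have mN : measurable_fun [set: measurableTypeR R]
  (-%R : measurableTypeR R -> measurableTypeR R) by [].
have mf := measurable_int _ intf.
have intfN : P.-integrable setT (EFin \o (fun x => f (- x))).
  have := integrableN intf; apply: eq_integrable => // x _ /=.
  by rewrite fN.
have ENf : (\int[P]_x (f x)%:E = - \int[P]_x (f x)%:E)%E.
  transitivity (\int[P]_x (f (- x))%:E)%E; last first.
    rewrite -integralN/=; last first.
      apply: fin_num_adde_defr; apply: integrable_fin_num => //.
      exact: integrable_funepos.
    by apply: eq_integral => x _; rewrite fN.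
  transitivity (\int[pushforward P
      (-%R : measurableTypeR R -> measurableTypeR R)]_x (f x)%:E)%E.
    apply: eq_measure_integral => A mA _.
    have := symP A mA; rewrite image_opprE => PA; exact: esym PA.
  exact: (integral_pushforward mN mf intfN).
have := integrable_fin_num measurableT intf.
rewrite unlock; move: ENf; case: integral => //= r [] r0 _.
by congr EFin; lra.
Qed.

(** * Integrals against the normal distribution and its density *)

(** By uniqueness, the density is almost everywhere the Radon-Nikodym derivative
of the distribution with respect to Lebesgue measure. *)
Lemma integral_normal_prob (R : realType) (m s : R) (f : R -> \bar R) :
  (normal_prob m s).-integrable setT f ->
  (\int[normal_prob m s]_x f x =
   \int[lebesgue_measure]_x (f x * (normal_pdf m s x)%:E))%E.
Proof.
move=> intf; have mf := measurable_int _ intf.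
have dom := normal_prob_dominates m s.
have mp : measurable_fun setT (EFin \o normal_pdf m s).
  by apply/measurable_EFinP; exact: measurable_normal_pdf.
rewrite -(Radon_Nikodym_change_of_variables dom)//=.
apply: ae_eq_integral => //.
- apply: (emeasurable_funM mf); apply: (measurable_int lebesgue_measure).
  by apply: Radon_Nikodym_integrable; exact: dom.
- exact: emeasurable_funM mf mp.
- apply: ae_eqe_mul2l => /=.
  apply: (integral_ae_eq measurableT) => [||E _ mE].
  + by apply: Radon_Nikodym_integrable; exact: dom.
  + exact: mp.
  + rewrite -Radon_Nikodym_integral//; exact: dom.
Qed.

Lemma integrable_normal_fun (R : realType) (s : R) : s != 0 ->
  lebesgue_measure.-integrable setT (EFin \o normal_fun 0 s).
Proof.
move=> s0.
have := integrable_normal_pdf 0 s.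
move=> /(integrableZl measurableT (normal_peak s)^-1).
apply: eq_integrable => //= x _.
by rewrite normal_pdfE// -EFinM mulKf// gt_eqF// normal_peak_gt0.
Qed.

(** The growth of |x| is absorbed by doubling the variance. With
q = x^2 / (4 s^2), the left-hand side is |x| e^(- q) e^(- q) and the right-hand
side is s e^(- q), so that the claim is |x| <= s e^q; it follows from
1 + q <= e^q and (|x| - 2 s)^2 >= 0. *)
Lemma normr_mul_normal_fun (R : realType) (s x : R) : 0 < s ->
  `|x| * normal_fun 0 s x <= s * normal_fun 0 (Num.sqrt 2 * s) x.
Proof.
move=> s0; rewrite /normal_fun !subr0 exprMn sqr_sqrtr//.
set q := x ^+ 2 / (s ^+ 2 * 4).
have -> : - x ^+ 2 / (s ^+ 2 *+ 2) = - q - q.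
  by rewrite /q; field; rewrite gt_eqF.
have -> : - x ^+ 2 / (2 * s ^+ 2 *+ 2) = - q.
  by rewrite /q; field; rewrite gt_eqF.
rewrite expRD mulrA ler_pM2r ?expR_gt0//.
rewrite expRN ler_pdivrMr ?expR_gt0//.
apply: (@le_trans _ _ (s * (1 + q))); last by rewrite ler_pM2l// expR_ge1Dx.
have -> : s * (1 + q) = s + `|x| ^+ 2 / (4 * s).
  by rewrite real_normK ?num_real// /q; field; rewrite gt_eqF.
rewrite -subr_ge0.
have -> : s + `|x| ^+ 2 / (4 * s) - `|x| = (`|x| - 2 * s) ^+ 2 / (4 * s).
  by field; rewrite gt_eqF.
by rewrite divr_ge0 ?sqr_ge0// mulr_ge0// ltW.
Qed.

(** * The fundamental theorem of calculus on the whole line *)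

(** The formula holds on the segments [- n - 1, n + 1]; dominated convergence,
with |f| as the dominating function, passes to the limit. It covers integrands
of variable sign. *)
Lemma integral_derive_eqB (R : realType) (F f : R -> R) (l m : R) :
  continuous f -> lebesgue_measure.-integrable setT (EFin \o f) ->
  (forall x : R, is_derive x 1 F (f x)) ->
  F x @[x --> +oo] --> l -> F x @[x --> -oo] --> m ->
  (\int[lebesgue_measure]_x (f x)%:E = (l - m)%:E)%E.
Proof.
move=> cf intf dF Fl Fm.
have mf := measurable_int _ intf.
(* n.+1 rather than n, so that the segment is never reduced to a point. *)
have FTC n : (\int[lebesgue_measure]_(x in `[(- n.+1%:R)%R, n.+1%:R%R])
    (f x)%:E = (F n.+1%:R - F (- n.+1%:R))%:E)%E.
  have cF : continuous F.
    by move=> x; apply/differentiable_continuous/derivable1_diffP.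
  rewrite EFinB; apply: continuous_FTC2.
  - by rewrite -subr_gt0 opprK -natrD.
  - exact: continuous_subspaceT.
  - split; [by []| |].
    + by apply: cvg_at_right_filter; exact: cF.
    + by apply: cvg_at_left_filter; exact: cF.
  - by move=> x _; rewrite derive1E derive_val.
have cvgS : (n.+1%:R : R) @[n --> \oo] --> +oo.
  have := @cvgr_idn R; rewrite -cvg_shiftS; exact.
have cvgl : (F n.+1%:R - F (- n.+1%:R))%:E @[n --> \oo] --> (l - m)%:E.
  apply: cvg_EFin; first exact: nearW.
  apply: cvgB; first exact: (cvg_comp _ F cvgS Fl).
  have /cvgNy_compNP := Fm.
  exact: (cvg_comp _ (F \o -%R) cvgS).
pose f_ n := (EFin \o f) \_ (`[- n.+1%:R, n.+1%:R]).
have mf_ n : measurable_fun setT (f_ n).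
  apply: (measurable_restrictT _ _).1; first exact: measurable_itv.
  exact: measurable_funTS.
have f_f x : f_ n x @[n --> \oo] --> (f x)%:E.
  apply: cvg_near_cst; near=> n.
  rewrite /f_ patchE mem_set//= in_itv/= -ler_norml.
  apply: ltW; apply: (@lt_trans _ _ n%:R); last by rewrite ltr_nat.
  by near: n; exact: nbhs_infty_gtr.
have f_le x n : (`|f_ n x| <= `|(f x)%:E|)%E.
  by rewrite /f_ patchE; case: ifPn => // _; rewrite abse0.
have [||_ _] := @dominated_convergence _ _ _ (@lebesgue_measure R) setT
    measurableT f_ (EFin \o f) (abse \o (EFin \o f)) mf_ mf _
    (integrable_abse intf) _.
- by apply: aeW => x _; exact: f_f.
- by apply: aeW => x n _; exact: f_le.
under eq_fun do rewrite -integral_mkcond FTC.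
by move=> /(cvg_unique _ cvgl) ->.
Unshelve. all: by end_near. Qed.

(** * Derivative, decay and first absolute moment of the density *)

(** The identity s^2 p'(x) = - x p(x), from which the differential equation for
the cosine transform is obtained. *)
Lemma is_derive_normal_pdf (R : realType) (s x : R) : s != 0 ->
  is_derive x 1 (normal_pdf 0 s) (- (x / s ^+ 2) * normal_pdf 0 s x).
Proof.
move=> s0; rewrite normal_pdfE//.
pose q : R -> R := fun y => - (y - 0) ^+ 2 / (s ^+ 2 *+ 2).
have dq : is_derive x 1 q (- (x / s ^+ 2)).
  rewrite /q; apply: is_derive_eq.
  by rewrite /GRing.scale/=; field.
have -> : (fun y => normal_peak s * normal_fun 0 s y) =
    (fun y => normal_peak s * (expR \o q) y) by [].
apply: is_derive_eq.
by rewrite /GRing.scale/= /normal_fun -/(q x); ring.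
Qed.

Lemma cvgy_normal_pdf (R : realType) (s : R) : 0 < s ->
  normal_pdf 0 s x @[x --> +oo] --> 0.
Proof.
move=> s0; have s1 : s != 0 by rewrite gt_eqF.
pose c := (Num.sqrt 2 * s)^-1.
have -> : normal_pdf 0 s = (fun x => normal_peak s * gauss_fun (x * c)).
  apply/funext => x; rewrite normal_pdfE//; congr (_ * expR _).
  rewrite subr0 /c exprMn exprVn exprMn sqr_sqrtr//.
  by field.
rewrite -(mulr0 (normal_peak s)); apply: cvgMr.
apply: (cvg_comp (fun x => x * c) gauss_fun); last exact: cvg_gauss_fun.
by apply: gt0_cvgMly; [rewrite invr_gt0 mulr_gt0|exact: cvg_id].
Qed.

Lemma cvgNy_normal_pdf (R : realType) (s : R) : 0 < s ->
  normal_pdf 0 s x @[x --> -oo] --> 0.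
Proof.
move=> s0; apply/cvgNy_compNP; have := cvgy_normal_pdf _ _ s0.
by under eq_fun do rewrite -normal_pdf0N ?gt_eqF//.
Qed.

Lemma integrable_normr_normal_pdf (R : realType) (s : R) : 0 < s ->
  lebesgue_measure.-integrable setT (fun x => (`|x| * normal_pdf 0 s x)%:E).
Proof.
move=> s0; have s1 : s != 0 by rewrite gt_eqF.
have t1 : Num.sqrt 2 * s != 0 by rewrite gt_eqF// mulr_gt0.
have := integrable_normal_fun _ _ t1.
move=> /(integrableZl measurableT (normal_peak s * s)).
apply: le_integrable => //.
  apply/measurable_EFinP; apply: measurable_funM; first exact: normr_measurable.
  exact: measurable_normal_pdf.
move=> x _; rewrite /= lee_fin normal_pdfE//.
rewrite !normrM normr_id !(ger0_norm (expR_ge0 _)).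
rewrite !(ger0_norm (normal_peak_ge0 _)) mulrCA -mulrA.
rewrite ler_pM2l ?normal_peak_gt0// gtr0_norm//.
exact: normr_mul_normal_fun.
Qed.

(** * The cosine transform of the density *)

Definition normal_cos_transform {R : realType} (s u : R) : R :=
  \int[lebesgue_measure]_x (cos (u * x) * normal_pdf 0 s x).

Lemma measurable_cosM (R : realType) (u : R) :
  measurable_fun [set: R] (fun x => cos (u * x)).
Proof.
apply: measurableT_comp; last exact: mulrl_measurable.
by apply: continuous_measurable_fun; exact: continuous_cos.
Qed.

Lemma measurable_sinM (R : realType) (u : R) :
  measurable_fun [set: R] (fun x => sin (u * x)).
Proof.
apply: measurableT_comp; last exact: mulrl_measurable.
by apply: continuous_measurable_fun; exact: continuous_sin.
Qed.

(** The role of f is to be played by a sine or a cosine. *)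
Lemma integrableM_le1 (R : realType) (f g h : R -> R) :
  measurable_fun setT f -> measurable_fun setT g -> (forall x, `|f x| <= 1) ->
  (forall x, `|g x| <= h x) ->
  lebesgue_measure.-integrable setT (EFin \o h) ->
  lebesgue_measure.-integrable setT (fun x => (f x * g x)%:E).
Proof.
move=> mf mg f1 gh; apply: le_integrable => //.
  by apply/measurable_EFinP; exact: measurable_funM.
move=> x _; rewrite /= lee_fin normrM (le_trans _ (ler_norm _))//.
by rewrite (le_trans _ (gh x))// ler_piMl.
Qed.

Lemma integrable_cosM_normal_pdf (R : realType) (s u : R) :
  lebesgue_measure.-integrable setT
    (fun x => (cos (u * x) * normal_pdf 0 s x)%:E).
Proof.
apply: integrableM_le1 (integrable_normal_pdf 0 s).
- exact: measurable_cosM.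
- exact: measurable_normal_pdf.
- by move=> x; exact: cos_max.
- by move=> x; rewrite ger0_norm// normal_pdf_ge0.
Qed.

Lemma integrable_sinM_mul_normal_pdf (R : realType) (s u : R) : 0 < s ->
  lebesgue_measure.-integrable setT
    (fun x => (sin (u * x) * (x * normal_pdf 0 s x))%:E).
Proof.
move=> s0; apply: integrableM_le1 (integrable_normr_normal_pdf _ _ s0).
- exact: measurable_sinM.
- by apply: measurable_funM => //; exact: measurable_normal_pdf.
- by move=> x; exact: sin_max.
- by move=> x; rewrite normrM [X in _ * X]ger0_norm// normal_pdf_ge0.
Qed.

(** The derivative of F(x) = s^2 sin(u x) p(x) is
s^2 u cos(u x) p(x) - x sin(u x) p(x), because s^2 p'(x) = - x p(x), and F
vanishes at both infinities. The integral of F' is thus zero. *)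
Lemma normal_cos_transform_by_parts (R : realType) (s u : R) : 0 < s ->
  \int[lebesgue_measure]_x (sin (u * x) * (x * normal_pdf 0 s x)) =
  s ^+ 2 * u * normal_cos_transform s u.
Proof.
move=> s0; have s1 : s != 0 by rewrite gt_eqF.
have intc := integrable_cosM_normal_pdf _ s u.
have ints := integrable_sinM_mul_normal_pdf _ _ u s0.
have cpdf := @continuous_normal_pdf R 0 s s1.
pose F (x : R) := s ^+ 2 * (sin (u * x) * normal_pdf 0 s x).
pose f (x : R) := s ^+ 2 * u * (cos (u * x) * normal_pdf 0 s x)
  - sin (u * x) * (x * normal_pdf 0 s x).
have dF (x : R) : is_derive x 1 F (f x).
  have dp := is_derive_normal_pdf _ _ x s1.
  have ds : is_derive x 1 (fun y => sin (u * y)) (u * cos (u * x)).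
    by apply: is_derive_eq; rewrite /GRing.scale/=; ring.
  by apply: is_derive_eq; rewrite /GRing.scale/= /f; field.
have ccos : continuous (fun x : R => cos (u * x)).
  move=> x; apply: continuous_comp; last exact: continuous_cos.
  exact: mulrl_continuous.
have csin : continuous (fun x : R => sin (u * x)).
  move=> x; apply: continuous_comp; last exact: continuous_sin.
  exact: mulrl_continuous.
have cf : continuous f.
  move=> x; apply: cvgB.
    by apply: cvgMr; apply: (cvgM (ccos x)); exact: cpdf.
  by apply: (cvgM (csin x)); apply: cvgM; [exact: cvg_id|exact: cpdf].
have intf1 := integrableZl measurableT (s ^+ 2 * u) intc.
have intf : lebesgue_measure.-integrable setT (EFin \o f).
  exact: (integrableB measurableT intf1 ints).
have F0 (D : set_system R) : Filter D -> normal_pdf 0 s x @[x --> D] --> 0 ->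
    F x @[x --> D] --> 0.
  move=> FD p0; rewrite -(mulr0 (s ^+ 2)); apply: cvgMr.
  apply: (@squeeze_cvgr _ _ _ _ (fun x => - normal_pdf 0 s x)
    (normal_pdf 0 s)) => //.
    apply: nearW => x; rewrite -ler_norml normrM.
    by rewrite (ger0_norm (normal_pdf_ge0 _ _ _)) ler_piMl ?sin_max//
      normal_pdf_ge0.
  rewrite -[0 in X in _ --> X]oppr0. apply: cvgN; exact: p0.
have := integral_derive_eqB _ F f 0 0 cf intf dF
  (F0 _ _ (cvgy_normal_pdf _ _ s0)) (F0 _ _ (cvgNy_normal_pdf _ _ s0)).
rewrite subrr => int0.
have : \int[lebesgue_measure]_x f x = 0 by rewrite /Rintegral int0.
rewrite /f RintegralB//= RintegralZl// => /eqP.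
by rewrite subr_eq0 => /eqP <-.
Qed.

(** The derivative of cos(v x) p(x) in v is bounded by |x| p(x) uniformly in v,
which justifies the differentiation under the integral sign around any u. *)
Lemma is_derive_normal_cos_transform (R : realType) (s u : R) : 0 < s ->
  is_derive u 1 (normal_cos_transform s)
    (- (s ^+ 2 * u * normal_cos_transform s u)).
Proof.
move=> s0.
pose f (v x : R) : R := cos (v * x) * normal_pdf 0 s x.
have df (v x : R) :
    is_derive v 1 (f ^~ x) (- (sin (v * x) * (x * normal_pdf 0 s x))).
  rewrite /f; apply: is_derive_eq.
  by rewrite /GRing.scale/=; ring.
have d1f v x : partial1of2 f v x = - (sin (v * x) * (x * normal_pdf 0 s x)).
  by rewrite partial1of2E derive_val.
have uI : `](u - 1), (u + 1)[%classic u.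
  by rewrite /= in_itv/=; apply/andP; split; lra.
have intf v : `](u - 1), (u + 1)[%classic v ->
    lebesgue_measure.-integrable [set: R] (EFin \o f v).
  by move=> _; exact: integrable_cosM_normal_pdf.
have derf v x : `](u - 1), (u + 1)[%classic v -> [set: R] x ->
  derivable (f ^~ x) v 1 by [].
have G0 (x : R) : 0 <= `|x| * normal_pdf 0 s x.
  by rewrite mulr_ge0 ?normal_pdf_ge0.
have G_ub v x : `](u - 1), (u + 1)[%classic v -> [set: R] x ->
    `|partial1of2 f v x| <= `|x| * normal_pdf 0 s x.
  move=> _ _; rewrite d1f normrN !normrM.
  by rewrite (ger0_norm (normal_pdf_ge0 _ _ _)) ler_piMl ?G0 ?sin_max.
have intG := integrable_normr_normal_pdf _ _ s0.
apply: DeriveDef.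
  exact: (derivable_under_integral measurableT uI intf derf G0 intG G_ub).
rewrite -derive1E.
rewrite (differentiation_under_integral measurableT uI intf derf G0 intG G_ub).
rewrite -normal_cos_transform_by_parts// -mulN1r -RintegralZl//.
  by apply: eq_Rintegral => x _; rewrite d1f mulN1r.
exact: integrable_sinM_mul_normal_pdf.
Qed.

(** The product with the inverse of the expected solution has derivative zero,
hence is constant. *)
Lemma normal_cos_transformE (R : realType) (s u : R) : 0 < s ->
  normal_cos_transform s u = expR (- (1 / 2) * s ^+ 2 * u ^+ 2).
Proof.
move=> s0.
pose h v := normal_cos_transform s v * expR (1 / 2 * s ^+ 2 * v ^+ 2).
have h_cst : h u = h 0.
  apply: is_derive_0_is_cst => v.
  have dG := is_derive_normal_cos_transform _ _ v s0.
  have dE : is_derive v 1 (fun v => expR (1 / 2 * s ^+ 2 * v ^+ 2))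
      (s ^+ 2 * v * expR (1 / 2 * s ^+ 2 * v ^+ 2)).
    by apply: is_derive_eq; rewrite /GRing.scale/=; field.
  apply: (is_derive_eq (is_deriveM dG dE)).
  by rewrite /GRing.scale/=; ring.
have h0 : h 0 = 1.
  rewrite /h expr0n mulr0 expR0 mulr1 /normal_cos_transform.
  under eq_Rintegral do rewrite mul0r cos0 mul1r.
  by rewrite /Rintegral integral_normal_pdf.
move: h_cst; rewrite h0 /h => /(canRL (mulfK (lt0r_neq0 (expR_gt0 _)))) ->.
by rewrite !mulNr expRN -[RHS]mul1r.
Qed.

(** * The characteristic function and the characteristic curvature *)

Lemma charfun_normal_prob (R : realType) (s u : R) : 0 < s ->
  charfun (normal_prob 0 s) u = (expR (- (1 / 2) * s ^+ 2 * u ^+ 2))%:C.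
Proof.
move=> s0; have s1 : s != 0 by rewrite gt_eqF.
have int1 : (normal_prob 0 s).-integrable setT (EFin \o cst (1 : R)).
  exact: finite_measure_integrable_cst.
have intc : (normal_prob 0 s).-integrable setT (fun x => (cos (u * x))%:E).
  apply: le_integrable int1 => //.
    by apply/measurable_EFinP; exact: measurable_cosM.
  by move=> x _; rewrite /= lee_fin normr1 cos_max.
have ints : (normal_prob 0 s).-integrable setT (fun x => (sin (u * x))%:E).
  apply: le_integrable int1 => //.
    by apply/measurable_EFinP; exact: measurable_sinM.
  by move=> x _; rewrite /= lee_fin normr1 sin_max.
rewrite /charfun /cexpectation /=; congr (_ +i* _).
  rewrite unlock integral_normal_prob// -normal_cos_transformE//.
rewrite (expectation_odd _ _ _ (symmetric_normal_prob _ _ s1) ints)//.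
by move=> x; rewrite mulrN sinN.
Qed.

Lemma integralT_normal_fun (R : realType) (s : R) : s != 0 ->
  (\int[lebesgue_measure]_x (normal_fun 0 s x)%:E = (normal_peak s)^-1%:E)%E.
Proof.
move=> s0; have p0 : normal_peak s != 0 by rewrite gt_eqF// normal_peak_gt0.
rewrite -[RHS]mule1 -(integral_normal_pdf 0 s) -integralZl//; last first.
  exact: integrable_normal_pdf.
by apply: eq_integral => x _; rewrite normal_pdfE// -EFinM mulKf.
Qed.

(** Half of the Gauss integral, by evenness. *)
Lemma integral0y_normal_fun (R : realType) (s : R) : s != 0 ->
  (\int[lebesgue_measure]_(x in `[0%R, +oo[) (normal_fun 0 s x)%:E =
   ((normal_peak s)^-1 / 2)%:E)%E.
Proof.
move=> s0.
have cn : continuous (normal_fun 0 s).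
  have -> : normal_fun 0 s = fun x => (normal_peak s)^-1 * normal_pdf 0 s x.
    apply/funext => x; rewrite normal_pdfE// mulKf//.
    by rewrite gt_eqF// normal_peak_gt0.
  by move=> x; apply: cvgMr; exact: continuous_normal_pdf.
have := integralT_normal_fun _ _ s0.
rewrite ge0_symfun_integralT//.
- rewrite -set_itvcy => /(congr1 (fun x => (2^-1)%:E * x)%E).
  by rewrite muleA -EFinM mulVf// mul1e => ->; rewrite -EFinM mulrC.
- by move=> x; exact: normal_fun_ge0.
- by move=> x; rewrite /= /normal_fun !subr0 sqrrN.
Qed.

Lemma derive1n2_quadratic (R : realType) (a u : R) :
  derive1n 2 (fun v : R => a * v ^+ 2) u = 2 * a.
Proof.
rewrite derive1nS/=.
have -> : (fun v : R => a * v ^+ 2)^`()%classic = (fun v : R => 2 * a * v).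
  apply/funext => v; rewrite derive1E.
  apply: (@derive_val _ _ _ _ _ _ _ _); apply: is_derive_eq.
  by rewrite /GRing.scale/=; ring.
rewrite derive1E; apply: (@derive_val _ _ _ _ _ _ _ _); apply: is_derive_eq.
by rewrite /GRing.scale/=; ring.
Qed.

Lemma characteristic_curvature_normal_prob (R : realType) (s : R) : 0 < s ->
  characteristic_curvature (normal_prob 0 s) = s%:E.
Proof.
move=> s0; have s1 : s != 0 by rewrite gt_eqF.
have sV0 : s^-1 != 0 by rewrite invr_eq0.
rewrite /characteristic_curvature; cbv zeta.
have lnphi : (fun v => ln (complex.Re (charfun (normal_prob 0 s) v))) =
    (fun v => (- (1 / 2) * s ^+ 2) * v ^+ 2).
  by apply/funext => v; rewrite charfun_normal_prob//= expRK.
rewrite lnphi.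
under eq_integral => u _.
  rewrite derive1n2_quadratic charfun_normal_prob//=.
  (* exp(- s^2 u^2 / 2) is a Gaussian in u with standard deviation 1 / s. *)
  rewrite (_ : - _ * _ = s ^+ 2 * normal_fun 0 s^-1 u); last first.
    by rewrite /normal_fun subr0; congr (_ * expR _); field.
  rewrite EFinM.
  over.
rewrite ge0_integralZl//; last 3 first.
- apply/measurable_EFinP/measurable_funTS; exact: measurable_normal_fun.
- by move=> x _; rewrite lee_fin normal_fun_ge0.
- by rewrite lee_fin sqr_ge0.
rewrite integral0y_normal_fun// -!EFinM; congr EFin.
have -> : (normal_peak s^-1)^-1 = s^-1 * Num.sqrt (2 * pi).
  rewrite /normal_peak invrK.
  have -> : s^-1 ^+ 2 * pi *+ 2 = s^-1 ^+ 2 * (2 * pi) by ring.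
  by rewrite sqrtrM ?sqr_ge0// sqrtr_sqr gtr0_norm// invr_gt0.
have r0 : Num.sqrt (2 * pi) != 0 :> R.
  by rewrite gt_eqF// sqrtr_gt0 mulr_gt0// pi_gt0.
by field; rewrite r0 s1.
Qed.

Theorem mainTheorem2 (R : realType) (sigma : R) (sigma_gt0 : 0 < sigma) :
  [/\ symmetric_prob (normal_prob 0 sigma),
      forall u : R,
        charfun (normal_prob 0 sigma) u =
        (expR (- (1 / 2) * sigma ^+ 2 * u ^+ 2))%:C &
      characteristic_curvature (normal_prob 0 sigma) = sigma%:E].
Proof.
split.
- by apply: symmetric_normal_prob; rewrite gt_eqF.
- by move=> u; exact: charfun_normal_prob.
- exact: characteristic_curvature_normal_prob.
Qed.
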